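(* Let $p\ge 5$ be a prime. Then $$\sum_{k=0}^{p-1}(2k+1)\,s_k\!\left(-\tfrac{1}{2}\right)^2\equiv \frac{3}{4}\left(\frac{-1}{p}\right)p^2 \pmod{p^4},$$ $$\sum_{k=0}^{p-1}(2k+1)\,s_k\!\left(-\tfrac{1}{3}\right)^2\equiv \frac{7}{9}\left(\frac{-3}{p}\right)p^2 \pmod{p^4},$$ $$\sum_{k=0}^{p-1}(2k+1)\,s_k\!\left(-\tfrac{1}{4}\right)^2\equiv \frac{13}{16}\left(\frac{-2}{p}\right)p^2 \pmod{p^4},$$ $$\sum_{k=0}^{p-1}(2k+1)\,s_k\!\left(-\tfrac{1}{6}\right)^2\equiv \frac{31}{36}\left(\frac{-1}{p}\right)p^2 \pmod{p^4}.$$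
   Context: For a non-negative integer $n$, define the polynomial $s_n(x)=\sum_{k=0}^n \binom{n}{k}\binom{x}{k}\binom{x+k}{k}$, where for a non-negative integer $k$ the generalized binomial coefficient is $\binom{y}{k}=y(y-1)\cdots(y-k+1)/k!$ (with $\binom{y}{0}=1$). $\left(\frac{\cdot}{p}\right)$ denotes the Legendre symbol modulo $p$. The quantities involved are rational numbers that are $p$-adic integers (denominators prime to $p$), and a congruence $a\equiv b \pmod{p^4}$ between such numbers means that $a-b$ is $p^4$ times a rational number whose denominator is prime to $p$ (equivalently, $a-b\in p^4\mathbb{Z}_p$). *)

(* Defs.v *)
From mathcomp Require Import all_boot all_order all_algebra.

Set Implicit Arguments.
Unset Strict Implicit.
Unset Printing Implicit Defensive.

Import Order.TTheory GRing.Theory Num.Theory.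
Local Open Scope ring_scope.

Definition gbin (y : rat) (k : nat) : rat :=
  (\prod_(i < k) (y - i%:R)) / (k`!)%:R.

Definition s (n : nat) (x : rat) : rat :=
  \sum_(k < n.+1) 'C(n, k)%:R * gbin x k * gbin (x + k%:R) k.

(* Only meaningful for p an odd prime. *)
Definition legendre (a : int) (p : nat) : int :=
  if (p %| a)%Z then 0
  else if [exists x : 'I_p, ((x : nat)%:Z ^+ 2 == a %[mod p])%Z] then 1
  else -1.

(* Congruence of rationals modulo p ^ e in the localization of Z at p. *)
Definition cong_ppow (p e : nat) (a b : rat) : Prop :=
  exists2 c : rat, ~~ (p%:Z %| denq c)%Z & a - b = p%:R ^+ e * c.

(* Main.v *)
Require Import Defs.
From HB Require Import structures.
From mathcomp Require Import all_boot all_order all_algebra cyclic finfield.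
From mathcomp Require Import ring zify.

Set Implicit Arguments.
Unset Strict Implicit.
Unset Printing Implicit Defensive.

Import Order.TTheory GRing.Theory Num.Theory.
Local Open Scope ring_scope.

(** Write S(x) for the sum of (2k+1) s_k(x)^2 over k < p.  The proof evaluates S
modulo p^4 at every natural number by walking from x - 1 to x, and then
transports the result to x = -1/d.

The walk rests on an exact identity.  Put X = x^2.  Both s_n(x) and s_n(x-1) are
governed by the same two polynomials in X: s_n(x) = E + x F and s_n(x-1) = E - x F,
with E and F the even and odd parts of s_n.  These satisfy first-order
recurrences in n, and the sum of (2k+1)(s_k(x)^2 + s_k(x-1)^2) over k < n,
multiplied by 1 - X, telescopes to 2 n^2 times a quadratic form in E and F
([square_sum_add_pred]).

For n = p almost every coefficient of E and F carries a binomial coefficient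
'C(p, k) divisible by p; only the last one, a product of the X - i^2 over 0 < i < p
divided by (p-1)!^2, has to be looked at.  It depends on the residue of x modulo p
only through the factors of that product divisible by p.  The outcome is a value
of S(x) + S(x-1) modulo p^4 for each residue:
- for x different from 0, 1, -1 modulo p it is 0 ([square_sum_step_unit]);
- for x = p t it is 2 p^2 (1 + t^2 - 2 p t^2) ([square_sum_step0]);
- for x = 1 + p t or x = -1 - p t it is - p^3 t (t+1)^2 ([square_sum_step1]).

Starting from the exact value of S(1), this gives by induction
S(a + p t) = (-1)^a p^2 (1 + t + t^2) modulo p^4 for 0 < a < p - 1, and for
a = p - 1 if p divides t ([square_sum_nat]): within a block of p consecutive integers only the sign
changes, and the three exceptional steps between two blocks combine so that the
terms in p^3 cancel.

Finally -1/d is congruent modulo p^4 to the integer (p^4-1)/d = a + p t with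
a = (p r - 1)/d and t = (p^3 - r)/d, where r is the residue of p modulo d.  For
d = 2, 3, 4, 6 every unit modulo d is its own inverse and equals 1 or -1, so that
t (t+1) is congruent to -(d-1)/d^2 and 1 + t + t^2 produces the constants
3/4, 7/9, 13/16, 31/36 ([square_sum_neg_inv]).  It remains to recognize (-1)^a as
a Legendre symbol: for -1 and -2 by Euler's criterion and Gauss's argument for
the power of 2, for -3 by the cube roots of unity. *)

(** * Splitting s_n into even and odd parts *)

Definition sqprod (X : rat) (k : nat) : rat :=
  \prod_(0 <= i < k) (X - i.+1%:R ^+ 2).

(** The first argument of both parts stands for x^2.  The even part of s_n in x is
[even_part X n.+1] and the odd part is x times [odd_part X n]; with this index
shift each recurrence below links consecutive states (see [s_split]). *)
Definition even_part (X : rat) (n : nat) : rat :=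
  \sum_(0 <= k < n) 'C(n, k.+1)%:R * (sqprod X k / k`!%:R ^+ 2).

Definition odd_part (X : rat) (n : nat) : rat :=
  \sum_(0 <= k < n) 'C(n, k.+1)%:R * (sqprod X k / (k`!%:R * k.+1`!%:R)).

Lemma fact_rat_neq0 k : (k`!)%:R != 0 :> rat.
Proof. by rewrite pnatr_eq0 -lt0n fact_gt0. Qed.

Lemma succ_rat_neq0 k : k.+1%:R != 0 :> rat.
Proof. by rewrite pnatr_eq0. Qed.

Local Ltac nat_neq0 :=
  by rewrite ?fact_rat_neq0 ?nat1r ?natr1 -?(natrD _ 2) ?pnatr_eq0.

Lemma factS_rat k : (k.+1`!)%:R = k.+1%:R * (k`!)%:R :> rat.
Proof. by rewrite factS natrM. Qed.

Lemma sqprod0 X : sqprod X 0 = 1.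
Proof. by rewrite /sqprod big_nil. Qed.

Lemma sqprodS X k : sqprod X k.+1 = sqprod X k * (X - k.+1%:R ^+ 2).
Proof. by rewrite /sqprod big_nat_recr. Qed.

Lemma sqprod_tail X k : sqprod X k.+1 = (X - 1) * \prod_(1 <= i < k.+1) (X - i.+1%:R ^+ 2).
Proof. by rewrite /sqprod big_ltn // expr1n. Qed.

Lemma gbin0 y : gbin y 0 = 1.
Proof. by rewrite /gbin big_ord0 fact0 divr1. Qed.

Lemma gbinS y k : gbin y k.+1 = gbin y k * (y - k%:R) / k.+1%:R.
Proof.
rewrite /gbin big_ord_recr /= factS_rat.
field; nat_neq0.
Qed.

Lemma gbin_nat n k : gbin n%:R k = 'C(n, k)%:R.
Proof.
elim: k => [|k IH]; first by rewrite gbin0 bin0.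
rewrite gbinS IH; apply: (mulIf (succ_rat_neq0 k)); rewrite divfK ?succ_rat_neq0 //.
have [le_kn|lt_nk] := leqP k n; last by rewrite !bin_small ?mul0r // ltnW.
by rewrite -natrB // -!natrM mulnC -mul_bin_left mulnC.
Qed.

Lemma gbin_absorb y k : gbin (y + 1) k.+1 = gbin y k * (y + 1) / k.+1%:R.
Proof.
elim: k => [|k IH]; first by rewrite gbinS !gbin0; field.
rewrite gbinS IH gbinS -[in LHS](natr1 k); field; nat_neq0.
Qed.

Lemma gbin2S x k :
  gbin x k.+1 * gbin (x + k.+1%:R) k.+1 =
  gbin x k * gbin (x + k%:R) k * ((x - k%:R) * (x + k.+1%:R) / k.+1%:R ^+ 2).
Proof.
rewrite -[in gbin (_ + _) _](natr1 k) addrA gbin_absorb gbinS -(natr1 k).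
field; nat_neq0.
Qed.

(** The 2 k + 2 consecutive factors x - k, ..., x + k + 1 pair up as
(x - i) (x + i), except x and x + k + 1. *)
Lemma gbin2E x k :
  gbin x k.+1 * gbin (x + k.+1%:R) k.+1 =
  x * (x + k.+1%:R) * sqprod (x ^+ 2) k / k.+1`!%:R ^+ 2.
Proof.
elim: k => [|k IH]; first by rewrite gbin2S !gbin0 sqprod0 factS_rat fact0; field.
rewrite gbin2S IH sqprodS [k.+2`!%:R]factS_rat.
field; nat_neq0.
Qed.

Lemma gbin2_pred x k :
  gbin (x - 1) k.+1 * gbin (x - 1 + k.+1%:R) k.+1 =
  x * (x - k.+1%:R) * sqprod (x ^+ 2) k / k.+1`!%:R ^+ 2.
Proof.
elim: k => [|k IH]; first by rewrite gbin2S !gbin0 sqprod0 factS_rat fact0; field.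
rewrite gbin2S IH sqprodS [k.+2`!%:R]factS_rat.
field; nat_neq0.
Qed.

(** Sums over n and over n.+1 can then be compared term by term. *)
Lemma sum_bin_widen (n N : nat) (g : nat -> rat) : (n <= N)%N ->
  \sum_(0 <= k < n) 'C(n, k.+1)%:R * g k = \sum_(0 <= k < N) 'C(n, k.+1)%:R * g k.
Proof.
move=> le_nN; rewrite [RHS](big_cat_nat (n := n)) //= [X in _ + X]big_nat.
rewrite [X in _ + X]big1 ?addr0 //.
by move=> i /andP[le_ni _]; rewrite bin_small ?mul0r.
Qed.

(** The factor n comes from n 'C(n, k) = k 'C(n, k) + (k+1) 'C(n, k+1): after
X times [sqprod X k] is expanded as [sqprod X k.+1] plus (k+1)^2 [sqprod X k],
X times [odd_part X n] becomes this combination, up to a telescoping sum. *)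
Lemma even_part_step X n : n%:R * even_part X n = n%:R * even_part X n.+1 - X * odd_part X n.
Proof.
rewrite /even_part (@sum_bin_widen n n.+1) ?leqnSn //.
rewrite [odd_part X n](@sum_bin_widen n n.+1) ?leqnSn //.
suff E : n%:R * (\sum_(0 <= k < n.+1) 'C(n, k)%:R * (sqprod X k / k`!%:R ^+ 2)) =
         X * \sum_(0 <= k < n.+1) 'C(n, k.+1)%:R * (sqprod X k / (k`!%:R * k.+1`!%:R)).
  rewrite -E -mulrBr -sumrB; congr (_ * _); apply: eq_bigr => k _.
  by rewrite binS natrD; ring.
have C k : k.+1%:R * 'C(n, k.+1)%:R = (n%:R - k%:R) * 'C(n, k)%:R :> rat.
  have [le_kn|lt_nk] := leqP k n; last by rewrite !bin_small ?mulr0 // ltnW.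
  by rewrite -natrB // -!natrM mul_bin_left.
pose g k : rat := k%:R * 'C(n, k)%:R * (sqprod X k / k`!%:R ^+ 2).
have -> : X * (\sum_(0 <= k < n.+1) 'C(n, k.+1)%:R * (sqprod X k / (k`!%:R * k.+1`!%:R))) =
   \sum_(0 <= k < n.+1) ((g k.+1 - g k) + n%:R * ('C(n, k)%:R * (sqprod X k / k`!%:R ^+ 2))).
  rewrite mulr_sumr; apply: eq_bigr => k _.
  transitivity (k.+1%:R * 'C(n, k.+1)%:R * (X * sqprod X k / k.+1`!%:R ^+ 2)).
    rewrite factS_rat; field; nat_neq0.
  rewrite /g sqprodS.
  transitivity (g k.+1 + k.+1%:R * 'C(n, k.+1)%:R * (sqprod X k / k`!%:R ^+ 2)).
    rewrite /g sqprodS factS_rat; field; nat_neq0.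
  by rewrite /g sqprodS !C; ring.
by rewrite big_split /= telescope_sumr // -mulr_sumr /g mul0r mul0r subr0 bin_small // mulr0 mul0r add0r.
Qed.

(** Pascal's rule together with (n+1) 'C(n, k) = (k+1) 'C(n+1, k+1). *)
Lemma odd_part_step X n : n.+1%:R * odd_part X n.+1 = n.+1%:R * odd_part X n + even_part X n.+1.
Proof.
rewrite [odd_part X n](@sum_bin_widen n n.+1) ?leqnSn //.
rewrite !mulr_sumr -big_split /=; apply: eq_bigr => k _.
have C : n.+1%:R * 'C(n, k)%:R = k.+1%:R * 'C(n.+1, k.+1)%:R :> rat.
  by rewrite -!natrM mul_bin_diag.
transitivity (n.+1%:R * ('C(n, k.+1)%:R * (sqprod X k / (k`!%:R * k.+1`!%:R))) +
     n.+1%:R * 'C(n, k)%:R * (sqprod X k / (k`!%:R * k.+1`!%:R))).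
  by rewrite binS natrD; ring.
rewrite C factS_rat; congr (_ + _); field; nat_neq0.
Qed.

Lemma s_recl x n (h : nat -> rat) :
  (forall k, gbin x k.+1 * gbin (x + k.+1%:R) k.+1 = h k) ->
  s n x = 1 + \sum_(0 <= k < n) 'C(n, k.+1)%:R * h k.
Proof.
move=> E; rewrite /s -(big_mkord xpredT (fun k => 'C(n, k)%:R * gbin x k * gbin (x + k%:R) k)).
rewrite big_nat_recl // bin0 !gbin0 !mul1r; congr (_ + _).
by apply: eq_bigr => k _; rewrite -mulrA E.
Qed.

(** This second form of the even part is the one that the definition of s yields;
the form of [even_part] has coefficients 'C(n, k.+1) like [odd_part]. *)
Lemma even_part_recl X n : even_part X n.+1 =
  1 + X * \sum_(0 <= k < n) 'C(n, k.+1)%:R * (sqprod X k / k.+1`!%:R ^+ 2).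
Proof.
elim: n => [|n IH].
  by rewrite /even_part big_nat1 !big_nil sqprod0 fact0 binn; field.
have n0 := succ_rat_neq0 n.
apply: (mulfI n0).
have := even_part_step X n.+1; rewrite IH.
move/eqP; rewrite eq_sym subr_eq => /eqP ->.
rewrite !mulrDr -addrA; congr (_ + _).
rewrite mulrCA -mulrDr [RHS]mulrCA; congr (_ * _).
rewrite [X in n.+1%:R * X + _](@sum_bin_widen n n.+1) ?leqnSn //.
rewrite !mulr_sumr -big_split /=; apply: eq_bigr => k _.
have C : n.+1%:R * 'C(n, k)%:R = k.+1%:R * 'C(n.+1, k.+1)%:R :> rat.
  by rewrite -!natrM mul_bin_diag.
transitivity (n.+1%:R * ('C(n, k.+1)%:R * (sqprod X k / k.+1`!%:R ^+ 2)) +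
   n.+1%:R * 'C(n, k)%:R * (sqprod X k / k.+1`!%:R ^+ 2)).
  rewrite C factS_rat; congr (_ + _); field; nat_neq0.
by rewrite [in RHS]binS natrD; ring.
Qed.

Lemma s_split x n : s n x = even_part (x ^+ 2) n.+1 + x * odd_part (x ^+ 2) n.
Proof.
rewrite (s_recl _ (gbin2E x)) even_part_recl -addrA; congr (_ + _).
rewrite !mulr_sumr -big_split /=; apply: eq_bigr => k _.
rewrite factS_rat; field; nat_neq0.
Qed.

Lemma s_split_pred x n : s n (x - 1) = even_part (x ^+ 2) n.+1 - x * odd_part (x ^+ 2) n.
Proof.
rewrite (s_recl _ (gbin2_pred x)) even_part_recl -addrA; congr (_ + _).
rewrite !mulr_sumr -sumrB /=; apply: eq_bigr => k _.
rewrite factS_rat; field; nat_neq0.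
Qed.

(** * Summation of the squares *)

Definition square_sum (n : nat) (x : rat) : rat :=
  \sum_(0 <= k < n) (2 * k + 1)%N%:R * s k x ^+ 2.

(** By [s_split] and [s_split_pred] the summand is twice (2k+1)(E^2 + X F^2).  Rewriting
the right-hand side for n and for n+1 in terms of the even part of s_n and of
[odd_part X n], through the two recurrences, makes the increment a polynomial
identity.  The parts occur only multiplied by n, so the same computation is valid
at n = 0. *)
Lemma square_sum_add_pred n x (X := x ^+ 2) :
  (1 - X) * (square_sum n x + square_sum n (x - 1)) =
  2 * n%:R ^+ 2 *
  (even_part X n ^+ 2 - 2 * X * even_part X n * odd_part X n + X * odd_part X n ^+ 2).
Proof.
elim: n => [|n IH]; first by rewrite /square_sum !big_nil; ring.
rewrite /square_sum !big_nat_recr //= -/(square_sum n x) -/(square_sum n (x - 1)) addrACA mulrDr {}IH.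
rewrite s_split s_split_pred -/X.
have e1 := even_part_step X n; have e2 := odd_part_step X n.
set e := even_part X n in e1 *; set e' := even_part X n.+1 in e1 e2 *.
set f := odd_part X n in e1 e2 *; set f' := odd_part X n.+1 in e2 *.
transitivity (2 * ((n%:R * e) ^+ 2 - 2 * X * (n%:R * e) * (n%:R * f) + X * (n%:R * f) ^+ 2)
  + (1 - X) * ((2 * n + 1)%N%:R * (e' + x * f) ^+ 2 + (2 * n + 1)%N%:R * (e' - x * f) ^+ 2)).
  by ring.
transitivity (2 * ((n.+1%:R * e') ^+ 2 - 2 * X * (n.+1%:R * e') * (n.+1%:R * f')
  + X * (n.+1%:R * f') ^+ 2)); last by ring.
rewrite e1 e2 natrD natrM -(natr1 n) /X; ring.
Qed.

(** At x = 1 the factor 1 - X vanishes, so the walk along the integers starts here. *)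
Lemma square_sum1 n : square_sum n 1 = 2 * n%:R ^+ 4 - n%:R ^+ 2.
Proof.
have s1 k : s k 1 = 1 + 2 * k%:R.
  rewrite (s_recl _ (gbin2E 1)); congr (_ + _).
  case: k => [|k]; first by rewrite big_geq // mulr0.
  rewrite big_nat_recl // big1_seq => [|i _].
    by rewrite bin1 sqprod0 addr0 factS_rat fact0; field.
  by rewrite expr1n sqprod_tail subrr !(mul0r, mulr0).
elim: n => [|n IH]; first by rewrite /square_sum big_nil; ring.
rewrite /square_sum big_nat_recr //= -/(square_sum n 1) IH s1 natrD natrM -(natr1 n); ring.
Qed.

(** * Factorials and products *)

(** The telescoping product of -(i-1)(i+1) for 2 <= i <= m + 1. *)
Lemma prod_one_sub_sq m :
  2 * \prod_(1 <= i < m.+1) (1 - i.+1%:R ^+ 2) = (-1) ^+ m * (m`!%:R * m.+2`!%:R) :> rat.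
Proof.
elim: m => [|m IH]; first by rewrite big_geq // !factS_rat fact0; ring.
by rewrite big_nat_recr // [LHS]mulrA IH [in RHS]exprS !factS_rat; ring.
Qed.

Lemma fact_even_odd k :
  (\prod_(0 <= i < k) (2 * i.+1) * \prod_(0 <= i < k) (2 * i).+1)%N = (2 * k)`!.
Proof.
elim: k => [|k IH]; first by rewrite !big_geq.
by rewrite mulnS !add2n !factS -IH !big_nat_recr //=; lia.
Qed.

(** The factors of n! sorted by parity; used to rearrange the even numbers up to
p - 1 in Gauss's computation of the power of 2. *)
Lemma fact_half_split n :
  (\prod_(0 <= i < n./2) (2 * i.+1) * \prod_(0 <= i < uphalf n) (2 * i).+1)%N = n`!.
Proof.
have := odd_double_half n; rewrite uphalf_half; case: (odd n) => /= nE.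
  rewrite -{3}nE add1n big_nat_recr //= mulnA fact_even_odd -mul2n factS; lia.
by rewrite fact_even_odd mul2n -{2}nE.
Qed.

(** * Rational numbers with denominator prime to p *)

Local Ltac in_subring := repeat first
  [ assumption | apply: rpred_nat | apply: rpred_int | apply: rpred1
  | apply: rpredX | apply: rpredD | rewrite rpredN | apply: rpredM ].

Section Prime.

Variables (p : nat) (p_prime : prime p) (p_ge5 : (5 <= p)%N).
Local Notation P := (p%:R : rat).
Local Notation cong := (cong_ppow p).

Lemma odd_p : odd p.
Proof. by have [p2|//] := even_prime p_prime; move: p_ge5; rewrite p2. Qed.

Lemma pred_half : p.-1 = (2 * p.-1./2)%N.
Proof. have := odd_p; lia. Qed.

Lemma signr_pred : (-1) ^+ p.-1 = 1 :> rat.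
Proof. by rewrite pred_half exprM sqrrN !expr1n. Qed.

Lemma prime_ndvd_fact k : (k < p)%N -> ~~ (p %| k`!)%N.
Proof.
elim: k => [|k IH] lt_kp; first by rewrite fact0 dvdn1 gtn_eqF ?prime_gt1.
by rewrite factS Euclid_dvdM // negb_or IH 1?ltnW // gtnNdvd.
Qed.

Lemma P_neq0 : P != 0.
Proof. by rewrite pnatr_eq0 -lt0n prime_gt0. Qed.

(** The primality proof is an argument so that the subring structure, which needs
it, can be attached to the predicate itself. *)
Definition plocal of prime p : {pred rat} := fun c => ~~ (p%:Z %| denq c)%Z.
Local Notation Zp := (plocal p_prime).

Lemma prime_dvdzM (a b : int) : (p %| a * b)%Z = (p %| a)%Z || (p %| b)%Z.
Proof. by rewrite !dvdzE abszM Euclid_dvdM. Qed.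

(** A denominator of c in lowest terms divides any integer m with c m integral. *)
Lemma plocal_mul_int (c : rat) (m n : int) :
  ~~ (p %| m)%Z -> c * m%:~R = n%:~R -> c \in Zp.
Proof.
move=> pm cE; rewrite unfold_in; apply: contra pm => /dvdz_trans; apply.
have /intr_inj E : (numq c * m)%:~R = (n * denq c)%:~R :> rat.
  by rewrite !intrM -cE numqE mulrAC.
rewrite -(@Gauss_dvdzr _ (numq c)) ?E ?dvdz_mull //.
by rewrite coprimez_sym coprimezE coprime_num_den.
Qed.

Lemma plocal_denq c : c \in Zp -> ~~ (p %| denq c)%Z.
Proof. by []. Qed.

Lemma plocal_subring : subring_closed Zp.
Proof.
split=> [|a b pa pb|a b pa pb].
- by rewrite unfold_in (denq_int 1) dvdz1 /= gtn_eqF ?prime_gt1.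
- apply: (@plocal_mul_int _ (denq a * denq b) (numq a * denq b - numq b * denq a)).
    by rewrite prime_dvdzM negb_or !plocal_denq.
  by rewrite !(intrM, intrB) !numqE; ring.
- apply: (@plocal_mul_int _ (denq a * denq b) (numq a * numq b)).
    by rewrite prime_dvdzM negb_or !plocal_denq.
  by rewrite !intrM !numqE; ring.
Qed.

HB.instance Definition _ := GRing.isSubringClosed.Build rat Zp plocal_subring.

Lemma plocal_inv (m : int) : ~~ (p %| m)%Z -> m%:~R^-1 \in Zp.
Proof.
move=> pm; apply: (@plocal_mul_int _ m 1) => //; rewrite mulVf // intr_eq0.
by apply: contra pm => /eqP ->; rewrite dvdz0.
Qed.

Lemma plocal_inv_nat (m : nat) : ~~ (p %| m)%N -> m%:R^-1 \in Zp.
Proof. by move=> pm; apply: (@plocal_inv m). Qed.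

Lemma plocal_fact k : (k < p)%N -> (k`!%:R)^-1 \in Zp.
Proof. by move=> lt_kp; rewrite plocal_inv_nat // prime_ndvd_fact. Qed.

Lemma congI e a b c : c \in Zp -> a - b = P ^+ e * c -> cong e a b.
Proof. by exists c. Qed.

Lemma congE e a b : cong e a b -> exists2 c, c \in Zp & a - b = P ^+ e * c.
Proof. by []. Qed.

Lemma cong_refl e a : cong e a a.
Proof. by apply: (@congI _ _ _ 0); rewrite ?rpred0 // subrr mulr0. Qed.

Lemma cong_trans e b a c : cong e a b -> cong e b c -> cong e a c.
Proof.
case/congE=> r rZ Er /congE[u uZ Eu]; apply: (@congI _ _ _ (r + u)).
  by rewrite rpredD.
by rewrite mulrDr -Er -Eu addrA subrK.
Qed.

Lemma congD e a b c d : cong e a b -> cong e c d -> cong e (a + c) (b + d).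
Proof.
case/congE=> r rZ Er /congE[u uZ Eu]; apply: (@congI _ _ _ (r + u)).
  by rewrite rpredD.
by rewrite mulrDr -Er -Eu opprD addrACA.
Qed.

Lemma congM e a b c d : b \in Zp -> c \in Zp ->
  cong e a b -> cong e c d -> cong e (a * c) (b * d).
Proof.
move=> bZ cZ /congE[r rZ Er] /congE[u uZ Eu].
apply: (@congI _ _ _ (r * c + b * u)); first by rewrite rpredD ?rpredM.
by rewrite mulrDr mulrA -Er mulrCA -Eu; ring.
Qed.

Lemma cong_plocal e a b : cong e a b -> b \in Zp -> a \in Zp.
Proof.
case/congE=> r rZ Er bZ; rewrite -[a](subrK b) Er.
by rewrite rpredD // rpredM // rpredX // rpred_nat.
Qed.

Lemma congMl e c a b : c \in Zp -> cong e a b -> cong e (c * a) (c * b).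
Proof.
move=> cZ /congE[r rZ Er]; apply: (@congI _ _ _ (c * r)); first by rewrite rpredM.
by rewrite -mulrBr Er mulrCA.
Qed.

Lemma cong_sum e (I : Type) (r : seq I) (Q : pred I) (f g : I -> rat) :
  (forall i, Q i -> cong e (f i) (g i)) ->
  cong e (\sum_(i <- r | Q i) f i) (\sum_(i <- r | Q i) g i).
Proof.
move=> fg; elim/big_rec2: _ => [|i a b Qi ab]; first exact: cong_refl.
by apply: congD => //; apply: fg.
Qed.

Lemma cong_prod e (I : Type) (r : seq I) (Q : pred I) (f g : I -> rat) :
  (forall i, Q i -> g i \in Zp) -> (forall i, Q i -> cong e (f i) (g i)) ->
  cong e (\prod_(i <- r | Q i) f i) (\prod_(i <- r | Q i) g i).
Proof.
move=> gZ fg; suff [] : cong e (\prod_(i <- r | Q i) f i) (\prod_(i <- r | Q i) g i) /\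
   \prod_(i <- r | Q i) g i \in Zp by [].
elim/big_rec2: _ => [|i a b Qi [ab aZ]]; first by split; [exact: cong_refl|rewrite rpred1].
split; last by rewrite rpredM // gZ.
by apply: congM; rewrite ?gZ ?(cong_plocal ab) //; apply: fg.
Qed.

(** If p divided the numerator of c, it would divide m. *)
Lemma plocal_unit (c : rat) (m : int) : c \in Zp -> ~~ (p %| m)%Z ->
  cong 1 c m%:~R -> c != 0 /\ c^-1 \in Zp.
Proof.
move=> cZ pm /congE[r rZ cm].
have pc : ~~ (p %| numq c)%Z.
  apply: contra pm => /dvdzP[k ck].
  have cE : c = P * (k%:~R / (denq c)%:~R).
    by rewrite -[LHS]divq_num_den ck intrM mulrAC mulrC.
  have E : m%:~R = P * (k%:~R / (denq c)%:~R - r) :> rat.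
    by rewrite mulrBr -cE -[P * r]cm; ring.
  have : k%:~R / (denq c)%:~R - r \in Zp.
    by rewrite rpredB // rpredM ?rpred_int // plocal_inv ?plocal_denq.
  set u := (_ - r) in E * => uZ; have pu := plocal_denq uZ.
  have /intr_inj/esym E' : (m * denq u)%:~R = (p%:Z * numq u)%:~R :> rat.
    by rewrite !intrM numqE mulrA -E.
  by have := dvdz_mulr (numq u) (dvdzz p); rewrite E' prime_dvdzM (negbTE pu) orbF.
have c0 : c != 0 by apply: contraNneq pc => ->; rewrite dvdz0.
split=> //; apply: (@plocal_mul_int _ (numq c) (denq c)) => //.
by rewrite numqE mulKf.
Qed.

Lemma plocal_sqprod X k : X \in Zp -> sqprod X k \in Zp.
Proof.
move=> XZ; rewrite rpred_prod // => i _.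
by rewrite rpredB // rpredX // rpred_nat.
Qed.

Lemma cong_gbin e y z k : (k < p)%N -> z \in Zp -> cong e y z -> cong e (gbin y k) (gbin z k).
Proof.
move=> lt_kp zZ yz; rewrite /gbin ![_ / k`!%:R]mulrC; apply: congMl; first exact: plocal_fact.
apply: cong_prod => i _; first by rewrite rpredB ?rpred_nat.
exact: congD yz (cong_refl _ _).
Qed.

Lemma plocal_gbin y k : (k < p)%N -> y \in Zp -> gbin y k \in Zp.
Proof.
move=> lt_kp yZ; rewrite rpredM ?plocal_fact // rpred_prod // => i _.
by rewrite rpredB ?rpred_nat.
Qed.

(** The coefficients of s_k for k < p have denominators dividing powers of (p-1)!,
so the sum is 1-Lipschitz in x for the p-adic distance. *)
Lemma cong_square_sum e y z : z \in Zp -> cong e y z -> cong e (square_sum p y) (square_sum p z).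
Proof.
move=> zZ yz; have yZ := cong_plocal yz zZ.
have sZ n x : (n < p)%N -> x \in Zp -> s n x \in Zp.
  move=> lt_np xZ; rewrite rpred_sum // => k _.
  have lt_kp : (k < p)%N by apply: leq_trans (ltn_ord k) _.
  rewrite rpredM ?plocal_gbin ?rpredD ?rpred_nat //.
  by rewrite rpredM ?plocal_gbin ?rpred_nat.
have s_cong n : (n < p)%N -> cong e (s n y) (s n z).
  move=> lt_np; apply: cong_sum => k _.
  have lt_kp : (k < p)%N by apply: leq_trans (ltn_ord k) _.
  have ykZ : y + k%:R \in Zp by rewrite rpredD ?rpred_nat.
  have zkZ : z + k%:R \in Zp by rewrite rpredD ?rpred_nat.
  apply: congM; first by rewrite rpredM ?rpred_nat ?plocal_gbin.
  - exact: plocal_gbin.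
  - by apply: congMl; [exact: rpred_nat | exact: cong_gbin].
  by apply: cong_gbin => //; apply: congD yz (cong_refl _ _).
rewrite /square_sum !big_mkord; apply: cong_sum => k _.
apply: congMl; first exact: rpred_nat.
have := s_cong k (ltn_ord k).
by rewrite !expr2 => sk; apply: congM; rewrite ?sZ.
Qed.

(** * The three kinds of steps modulo p^4 *)

Definition top_term (X : rat) : rat := sqprod X p.-1 / p.-1`!%:R ^+ 2.

Lemma sum_bin_prime (g : nat -> rat) : (forall k, (k < p.-1)%N -> g k \in Zp) ->
  exists2 c, c \in Zp & \sum_(0 <= k < p) 'C(p, k.+1)%:R * g k = P * c + g p.-1.
Proof.
move=> gZ; have p_gt0 := prime_gt0 p_prime.
exists (\sum_(0 <= k < p.-1) ('C(p, k.+1) %/ p)%:R * g k).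
  by rewrite big_mkord rpred_sum // => k _; rewrite rpredM ?rpred_nat ?gZ.
have big_recr (F : nat -> rat) : \sum_(0 <= k < p) F k = \sum_(0 <= k < p.-1) F k + F p.-1.
  by rewrite -(big_nat_recr p.-1 0) // prednK.
rewrite big_recr prednK // binn mul1r; congr (_ + _).
rewrite mulr_sumr [LHS]big_nat [RHS]big_nat; apply: eq_bigr => k /= lt_kp.
rewrite mulrA -natrM [(p * _)%N]mulnC divnK // prime_dvd_bin //=; lia.
Qed.

Lemma even_part_prime X : X \in Zp ->
  exists2 c, c \in Zp & even_part X p = P * c + top_term X.
Proof.
move=> XZ; apply: sum_bin_prime => k lt_kp.
have lt_kp' : (k < p)%N by lia.
by rewrite rpredM ?plocal_sqprod // -exprVn rpredX ?plocal_fact.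
Qed.

Lemma odd_part_prime X : X \in Zp ->
  exists2 c, c \in Zp & odd_part X p = P * c + top_term X / P.
Proof.
have p_gt0 := prime_gt0 p_prime; have p0 := P_neq0.
move=> XZ; rewrite /odd_part.
have [|c cZ ->] := @sum_bin_prime (fun k => sqprod X k / (k`!%:R * k.+1`!%:R)).
  move=> k lt_kp; have lt_kp' : (k < p)%N by lia.
  by rewrite rpredM ?plocal_sqprod // invfM rpredM ?plocal_fact //; lia.
exists c => //; congr (_ + _); rewrite /top_term factS_rat prednK //.
by field; rewrite p0 fact_rat_neq0.
Qed.

(** The factors x - i and x + i of [top_term], for 0 < i < p, complete to two
products of p consecutive integers; this exhibits the factor p^2 when x is a unit. *)
Lemma top_term_nat n (x := n%:R : rat) :
  x * (x + P) * top_term (x ^+ 2) = P ^+ 2 * ('C(n, p) * 'C(n + p, p))%N%:R.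
Proof.
have p_gt0 := prime_gt0 p_prime; have p0 := P_neq0.
have := gbin2E x p.-1; rewrite prednK // -natrD !gbin_nat natrM => ->.
rewrite -[in p`!](prednK p_gt0) factS_rat prednK // /top_term.
by field; rewrite p0 fact_rat_neq0.
Qed.

(** Here [top_term] is divisible by p^2, hence the even and odd parts are divisible
by p and the quadratic form by p^2, while 1 - X is a unit. *)
Lemma square_sum_step_unit n (x := n%:R : rat) : ~~ (p %| n)%N -> ~~ (p %| n%:Z ^+ 2 - 1)%Z ->
  cong 4 (square_sum p x + square_sum p (x - 1)) 0.
Proof.
move=> pn pn1; have p_gt0 := prime_gt0 p_prime; have p0 := P_neq0.
set X := x ^+ 2.
have xZ : x \in Zp by apply: rpred_nat.
have XZ : X \in Zp by rewrite rpredX.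
have [c cZ eE] := even_part_prime XZ; have [d dZ fE] := odd_part_prime XZ.
have X1 : (n%:Z ^+ 2 - 1)%:~R = X - 1 by rewrite intrB rmorphXn.
have X1n0 : X - 1 != 0.
  by rewrite -X1 intr_eq0; apply: contra pn1 => /eqP ->; rewrite dvdz0.
have iZ : (X - 1)^-1 \in Zp by rewrite -X1 plocal_inv.
have x0 : x != 0 by rewrite pnatr_eq0; apply: contra pn => /eqP ->; rewrite dvdn0.
have xp0 : x + P != 0 by rewrite -natrD pnatr_eq0 -lt0n addn_gt0 p_gt0 orbT.
have [w wZ wE] : exists2 w, w \in Zp & top_term X = P ^+ 2 * w.
  exists (x^-1 * (x + P)^-1 * ('C(n, p) * 'C(n + p, p))%N%:R).
    rewrite rpredM ?rpred_nat // rpredM ?plocal_inv_nat //.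
    by rewrite -natrD plocal_inv_nat // dvdn_addl.
  apply: (mulfI (mulf_neq0 x0 xp0)); rewrite top_term_nat -/x.
  by field; rewrite x0 xp0.
have -> : square_sum p x + square_sum p (x - 1) =
   (2 * P ^+ 2 * (even_part X p ^+ 2 - 2 * X * even_part X p * odd_part X p
      + X * odd_part X p ^+ 2)) / (1 - X).
  by rewrite -square_sum_add_pred -/X mulrAC divff ?mul1r // subr_eq0 eq_sym -subr_eq0.
rewrite eE fE wE.
apply: (@congI _ _ _ (- (2 * ((c + P * w) ^+ 2
  - 2 * X * (c + P * w) * (d + w) + X * (d + w) ^+ 2) / (X - 1)))).
  have PZ : P \in Zp by apply: rpred_nat.
  have cwZ : c + P * w \in Zp by rewrite rpredD ?rpredM.
  have dwZ : d + w \in Zp by rewrite rpredD.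
  rewrite rpredN rpredM // rpredM ?rpred_nat // rpredD // ?rpredM ?rpredX // rpredB ?rpredX //.
  by rewrite rpredM // rpredM // rpredM // rpred_nat.
rewrite subr0; field; rewrite p0 X1n0 andbT.
by rewrite subr_eq0 eq_sym -subr_eq0.
Qed.

(** Modulo X the product reduces to that of the -i^2. *)
Lemma sqprod_cong0 X k : cong 2 X 0 -> (k < p)%N -> cong 2 (sqprod X k / k`!%:R ^+ 2) ((-1) ^+ k).
Proof.
move=> X0 lt_kp.
have -> : (-1) ^+ k = (\prod_(0 <= i < k) (0 - i.+1%:R ^+ 2)) / k`!%:R ^+ 2 :> rat.
  apply: (mulIf (expf_neq0 2 (fact_rat_neq0 k))).
  rewrite divfK ?expf_neq0 ?fact_rat_neq0 //.
  elim: (k) => [|j IH]; first by rewrite big_nil fact0 mul1r expr1n.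
  by rewrite big_nat_recr //= -IH factS_rat exprS; ring.
rewrite ![_ / _]mulrC; apply: congMl.
  by rewrite -exprVn rpredX ?plocal_fact.
apply: cong_prod => i _.
  by rewrite rpredB ?rpred0 ?rpredX ?rpred_nat.
exact: congD X0 (cong_refl _ _).
Qed.

Lemma sum_bin_alt : \sum_(0 <= k < p) 'C(p, k.+1)%:R * (-1) ^+ k = 1 :> rat.
Proof.
have p_gt0 := prime_gt0 p_prime.
have := exprBn (1 : rat) 1 p; rewrite subrr expr0n gtn_eqF //=.
rewrite -(big_mkord xpredT (fun i => ((-1) ^+ i * 1 ^+ (p - i) * 1 ^+ i) *+ 'C(p, i))).
rewrite big_nat_recl // bin0 !expr1n expr0 !mulr1 mulr1n => /eqP.
rewrite eq_sym addrC addr_eq0 => /eqP E.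
apply: oppr_inj; rewrite -[RHS]E -sumrN; apply: eq_bigr => k _.
by rewrite !expr1n !mulr1 -mulr_natl exprS; ring.
Qed.

(** By [sqprod_cong0] the even part is 1 modulo p^2, as an alternating sum of binomial
coefficients.  The odd part has a denominator p, but p times it is also 1 modulo
p^2, and it enters the quadratic form only through X F = p t^2 (p F) and
X F^2 = t^2 (p F)^2. *)
Lemma square_sum_step0 (x t : rat) : t \in Zp -> x = P * t ->
  cong 4 (square_sum p x + square_sum p (x - 1)) (2 * P ^+ 2 * (1 + t ^+ 2 - 2 * P * t ^+ 2)).
Proof.
move=> tZ xE; have p_gt0 := prime_gt0 p_prime; have p0 := P_neq0.
set X := x ^+ 2.
have PZ : P \in Zp by apply: rpred_nat.
have xZ : x \in Zp by rewrite xE rpredM.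
have XZ : X \in Zp by rewrite rpredX.
have XE : X = P ^+ 2 * t ^+ 2 by rewrite /X xE exprMn.
have X0 : cong 2 X 0 by apply: (@congI _ _ _ (t ^+ 2)); rewrite ?rpredX // subr0.
have /congE[a aZ eE] : cong 2 (even_part X p) 1.
  rewrite -sum_bin_alt /even_part !big_mkord; apply: cong_sum => k _.
  by apply: congMl; [exact: rpred_nat|exact: sqprod_cong0].
have /congE[b bZ fE] : cong 2 (P * odd_part X p) 1.
  have [d dZ ->] := odd_part_prime XZ.
  have /congE[w wZ wE] : cong 2 (top_term X) 1.
    have := sqprod_cong0 X0 (_ : p.-1 < p)%N; rewrite -/(top_term X) ltn_predL p_gt0 => /(_ isT).
    by rewrite signr_pred.
  apply: (@congI _ _ _ (d + w)); first by rewrite rpredD.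
  by rewrite !mulrDr -wE; field.
have [X1n0 iZ] : 1 - X != 0 /\ (1 - X)^-1 \in Zp.
  apply: (@plocal_unit _ 1); rewrite ?rpredB ?rpred1 //.
    by rewrite dvdzE /= dvdn1 gtn_eqF ?prime_gt1.
  apply: (@congI _ _ _ (- (P * t ^+ 2))); first by rewrite rpredN rpredM ?rpredX.
  by rewrite XE; ring.
have -> : square_sum p x + square_sum p (x - 1) =
   (2 * (P ^+ 2 * even_part X p ^+ 2 - 2 * P * X * even_part X p * (P * odd_part X p)
      + X * (P * odd_part X p) ^+ 2)) / (1 - X).
  apply: (mulfI X1n0); rewrite square_sum_add_pred -/X.
  by field.
have -> : even_part X p = 1 + P ^+ 2 * a by rewrite -eE; ring.
have -> : P * odd_part X p = 1 + P ^+ 2 * b by rewrite -fE; ring.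
(* The quadratic form minus (1 - X) (1 + t^2 - 2 p t^2) is p^2 r. *)
pose r := 2 * a + P ^+ 2 * a ^+ 2 - 2 * P * t ^+ 2 * (a + b + P ^+ 2 * a * b)
    + t ^+ 2 * (2 * b + P ^+ 2 * b ^+ 2) + t ^+ 2 * (1 + t ^+ 2 - 2 * P * t ^+ 2).
apply: (@congI _ _ _ (2 * r * (1 - X)^-1)).
  by rewrite /r; in_subring.
rewrite /r; move: X1n0; rewrite XE => X1n0; field; by rewrite exprMn.
Qed.

(** Now 1 - X is divisible by p t and must be cancelled.  With E and F the two parts,
the quadratic form equals (E - X F)^2 + X (1 - X) F^2, and E - X F is itself
divisible by X - 1, coefficient by coefficient: the term for k contains
[sqprod X k], hence X - 1, if k > 0, and equals 1 - X up to a binomial if k = 0.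
Writing E - X F = (X - 1) g turns the sum into 2 p^2 ((1 - X) g^2 + X F^2), where
F is divisible by p; so only g modulo p matters, and 2 g = -(t+1) modulo p because
the last coefficient contributes and the others do not.  The hypothesis on x^2
covers both signs of x. *)
Lemma square_sum_step1 (x t : rat) : t != 0 -> t \in Zp -> x ^+ 2 = (1 + P * t) ^+ 2 ->
  2 + P * t != 0 ->
  cong 4 (square_sum p x + square_sum p (x - 1)) (- (P ^+ 3 * t * (t + 1) ^+ 2)).
Proof.
move=> t0 tZ xE pt2; have p_gt0 := prime_gt0 p_prime; have p0 := P_neq0.
pose X := (1 + P * t) ^+ 2.
have PZ : P \in Zp by apply: rpred_nat.
have XZ : X \in Zp by rewrite rpredX // rpredD ?rpred1 ?rpredM.
have X1 : X - 1 = P * t * (2 + P * t) by rewrite /X; ring.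
have X1n0 : 1 - X != 0 by rewrite -opprB oppr_eq0 X1 !mulf_neq0.
have [m pE] : exists m, p = m.+3 by exists (p - 3)%N; lia.
(* z is top_term / (p (X - 1)): the factor of index 0 is X - 1, the factor of index
   p - 2 is (x - (p-1)) (x + (p-1)) for x = 1 + p t, equal to
   (2 + p t - p) (p t + p), and R gathers the others. *)
pose R := \prod_(1 <= i < m.+1) (X - i.+1%:R ^+ 2).
pose z := (t + 1) * (2 + P * t - P) * R / p.-1`!%:R ^+ 2.
have topE : top_term X = (X - 1) * P * z.
  rewrite /top_term {1}pE /= sqprodS sqprod_tail -/R /z.
  have -> : m.+2%:R = P - 1 by rewrite [P](_ : _ = m.+2%:R + 1) ?addrK // natr1 -pE.
  rewrite /X; field; exact: fact_rat_neq0.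
have zE : cong 1 (2 * z) (t + 1).
  have : cong 1 (2 * R) (2 * \prod_(1 <= i < m.+1) (1 - i.+1%:R ^+ 2)).
    apply: congMl; first exact: rpred_nat.
    apply: cong_prod => i _; first by rewrite rpredB ?rpred1 ?rpredX ?rpred_nat.
    apply: (@congI _ _ _ (t * (2 + P * t))).
      by rewrite rpredM // rpredD ?rpred_nat ?rpredM.
    by rewrite mulrA -X1; ring.
  rewrite prod_one_sub_sq => /congE[rho rhoZ RE].
  have m1 : (-1) ^+ m = 1 :> rat.
    by have := signr_pred; rewrite pE /= !exprS !mulN1r opprK.
  have uE : p.-1`!%:R = (P - 1) * (P - 2) * m`!%:R :> rat.
    rewrite pE /= !factS_rat -(natr1 m.+2) -(natr1 m.+1); ring.
  have R2 : 2 * R = m`!%:R * p.-1`!%:R + P * rho.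
    by rewrite -[P * rho]RE m1 pE /=; ring.
  have f0 := fact_rat_neq0 p.-1.
  have phiZ : (p.-1`!%:R)^-1 \in Zp by apply: plocal_fact; lia.
  set phi := (p.-1`!%:R)^-1 in phiZ.
  have phiE : (P - 1) * (P - 2) * m`!%:R * phi = 1 by rewrite -uE divff.
  have phiE' : p.-1`!%:R * phi = 1 by rewrite divff.
  apply: (@congI _ _ _ ((t + 1) * ((t - 1) * (m`!%:R * phi) - (P - 3) * (m`!%:R * phi)
      + (2 + P * (t - 1)) * rho * phi ^+ 2))).
    by in_subring.
  have -> : 2 * z = (t + 1) * (2 + P * t - P) * (2 * R) * phi ^+ 2.
    by rewrite /z /phi; field.
  rewrite R2.
  transitivity ((t + 1) * ((2 + P * t - P) * (m`!%:R * phi * (p.-1`!%:R * phi) + P * rho * phi ^+ 2)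
      - (P - 1) * (P - 2) * m`!%:R * phi)).
    by rewrite phiE; ring.
  by rewrite phiE'; ring.
have /congE[zeta zetaZ zetaE] := zE.
have two_local : 2^-1 \in Zp by apply: plocal_inv_nat; rewrite gtnNdvd //; lia.
have zZ : z \in Zp.
  have -> : z = (2 * z) * 2^-1 by field.
  by rewrite rpredM // (cong_plocal zE) // rpredD ?rpred1.
have [d dZ fE] := odd_part_prime XZ.
(* b k is the coefficient of E - X F divided by X - 1. *)
pose b k : rat := if k is j.+1 then
  \prod_(1 <= i < k) (X - i.+1%:R ^+ 2) * (k.+1%:R - X) / (k`!%:R * k.+1`!%:R) else -1.
have [|c cZ bE] := @sum_bin_prime b.
  case=> [_|k lt_kp]; first by rewrite rpredN1.
  rewrite /b; apply: rpredM; last by rewrite invfM; apply: rpredM; apply: plocal_fact; lia.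
  apply: rpredM; last by in_subring.
  by apply: rpred_prod => i _; in_subring.
have bp : b p.-1 = (P - X) * z.
  have := topE; rewrite /top_term {1}pE /= sqprod_tail.
  set T := (\prod_(_ <= i < _) _) => tE.
  have X10 : X - 1 != 0 by rewrite -opprB oppr_eq0.
  have TE : T / p.-1`!%:R ^+ 2 = P * z.
    by apply: (mulfI X10); rewrite [RHS]mulrA -tE mulrA.
  have p1 : p.-1 = m.+2 by rewrite pE.
  have bS k : b k.+1 =
      \prod_(1 <= i < k.+1) (X - i.+1%:R ^+ 2) * (k.+2%:R - X) / (k.+1`!%:R * k.+2`!%:R).
    by [].
  transitivity (T / p.-1`!%:R ^+ 2 * (P - X) / P); last by rewrite TE; field.
  rewrite {1}p1 bS -/T p1 [m.+3`!%:R]factS_rat -pE; field.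
  by rewrite p0 fact_rat_neq0.
pose f1 := d + t * (2 + P * t) * z.
have f1E : odd_part X p = P * f1.
  by rewrite fE topE X1 /f1; field.
pose g := P * c + (P - X) * z.
have gE : even_part X p - X * odd_part X p = (X - 1) * g.
  rewrite /g -bp -bE mulr_sumr /even_part /odd_part mulr_sumr -sumrB; apply: eq_bigr => k _.
  case: k => [|k].
    by rewrite /b !sqprod0 factS_rat fact0; field.
  rewrite /b sqprod_tail [k.+2`!%:R]factS_rat; field.
  by rewrite fact_rat_neq0 -(natrD _ 2) pnatr_eq0.
have gP : 2 * g = - (t + 1) + P * (2 * c + 2 * z * (1 - t * (2 + P * t)) - zeta).
  have -> : P * (2 * c + 2 * z * (1 - t * (2 + P * t)) - zeta) =
    P * (2 * c + 2 * z * (1 - t * (2 + P * t))) - P ^+ 1 * zeta by ring.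
  by rewrite -zetaE /g /X; ring.
set gam := (_ - zeta) in gP.
have gamZ : gam \in Zp by rewrite /gam; in_subring.
have -> : square_sum p x + square_sum p (x - 1) =
   P ^+ 2 * (- (P * t * (2 + P * t)) * (2 * g) ^+ 2 / 2 + 2 * X * P ^+ 2 * f1 ^+ 2).
  apply: (mulfI X1n0); rewrite {1}/X -xE square_sum_add_pred xE -/X.
  transitivity (2 * P ^+ 2 * ((even_part X p - X * odd_part X p) ^+ 2 + X * (1 - X) * odd_part X p ^+ 2)).
    by ring.
  by rewrite gE f1E -X1; field.
rewrite gP.
have f1Z : f1 \in Zp by rewrite /f1; in_subring.
apply: (@congI _ _ _ (- (t ^+ 2 * (t + 1) ^+ 2 * 2^-1)
   - t * (2 + P * t) * 2^-1 * (- (2 * (t + 1) * gam) + P * gam ^+ 2) + 2 * X * f1 ^+ 2)).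
  by in_subring.
by field.
Qed.

(** * The sum at natural numbers *)

Definition block_value (t : nat) : rat := P ^+ 2 * (1 + t%:R + t%:R ^+ 2).

Lemma cong_step n (u v : rat) : cong 4 (square_sum p n.+1%:R + square_sum p (n.+1%:R - 1)) u ->
  cong 4 (square_sum p n%:R) v -> cong 4 (square_sum p n.+1%:R) (u - v).
Proof.
move=> Hs Hn; have -> : square_sum p n.+1%:R =
    (square_sum p n.+1%:R + square_sum p (n.+1%:R - 1)) - square_sum p n%:R.
  by rewrite -[n.+1%:R](natr1 n) !addrK.
apply: (congD Hs).
by rewrite -mulN1r -[- v]mulN1r; apply: congMl; rewrite ?rpredN1.
Qed.

Lemma square_sum_block t a : cong 4 (square_sum p (1 + p * t)%N%:R) (- block_value t) ->
  (0 < a)%N -> (a <= p - 2)%N ->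
  cong 4 (square_sum p (a + p * t)%N%:R) ((-1) ^+ a * block_value t).
Proof.
move=> H1; case: a => // a _; elim: a => [|a IH] le_ap; first by rewrite mulN1r.
have {}IH := IH (ltnW le_ap).
have -> : (-1) ^+ a.+2 * block_value t = 0 - (-1) ^+ a.+1 * block_value t by rewrite exprS; ring.
rewrite addSn; apply: cong_step => //.
have E : (a.+1 + p * t).+1 = (a.+2 + p * t)%N by rewrite addSn.
apply: square_sum_step_unit => //.
  by rewrite E dvdn_addl ?dvdn_mulr // gtnNdvd //; lia.
have -> : (a.+1 + p * t).+1%:Z ^+ 2 - 1 = (a.+1 + p * t)%N%:Z * (a.+3 + p * t)%N%:Z by lia.
rewrite prime_dvdzM // negb_or !dvdzE /= !dvdn_addl ?dvdn_mulr //.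
by rewrite !gtnNdvd //; lia.
Qed.

(** The step to x = p - 1 + p t is the one of [square_sum_step1] at
-x = 1 - p (t+1). *)
Lemma square_sum_last t : cong 4 (square_sum p (1 + p * t)%N%:R) (- block_value t) ->
  cong 4 (square_sum p (p.-1 + p * t)%N%:R) (block_value t + P ^+ 3 * (t%:R + 1) * t%:R ^+ 2).
Proof.
move=> H1; have H2 := @square_sum_block t (p - 2) H1 ltac:(lia) (leqnn _).
have E : (p.-1 + p * t)%N = (p - 2 + p * t).+1 by lia.
have -> : block_value t + P ^+ 3 * (t%:R + 1) * t%:R ^+ 2 =
  - (P ^+ 3 * (- (t%:R + 1)) * (- (t%:R + 1) + 1) ^+ 2) - (- block_value t) by ring.
rewrite E; apply: cong_step; last first.
  by have -> : - block_value t = (-1) ^+ (p - 2) * block_value t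
    by rewrite -signr_odd oddB ?odd_p ?mulN1r //; lia.
apply: square_sum_step1 => //.
- by rewrite oppr_eq0 natr1 pnatr_eq0.
- by in_subring.
- rewrite -E natrD natrM -subn1 natrB; last by lia.
  by ring.
- rewrite mulrN subr_eq0 natr1 -natrM eqr_nat; nia.
Qed.

(** Three exceptional steps, at x = -1, 0, 1 modulo p, separate the two blocks; their
p^3 parts t^2 (t+1), -4 (t+1)^2 and -(t+1)(t+2)^2 enter with alternating signs
and cancel. *)
Lemma square_sum_next t : cong 4 (square_sum p (1 + p * t)%N%:R) (- block_value t) ->
  cong 4 (square_sum p (1 + p * t.+1)%N%:R) (- block_value t.+1).
Proof.
move=> H1; have := square_sum_last H1.
set v := (block_value t + _) => H2.
have E : (p * t.+1)%N = (p.-1 + p * t).+1 by lia.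
have {H2} H3 : cong 4 (square_sum p (p * t.+1)%N%:R)
   (2 * P ^+ 2 * (1 + t.+1%:R ^+ 2 - 2 * P * t.+1%:R ^+ 2) - v).
  rewrite E; apply: cong_step => //.
  apply: square_sum_step0 => //; first exact: rpred_nat.
  by rewrite -E natrM.
have -> : - block_value t.+1 = - (P ^+ 3 * t.+1%:R * (t.+1%:R + 1) ^+ 2) -
    (2 * P ^+ 2 * (1 + t.+1%:R ^+ 2 - 2 * P * t.+1%:R ^+ 2) - v).
  by rewrite /v /block_value -(natr1 t); ring.
rewrite add1n; apply: cong_step => //.
apply: square_sum_step1 => //.
- by rewrite pnatr_eq0.
- exact: rpred_nat.
- by rewrite -natr1 natrM addrC.
- by rewrite -natrM -natrD pnatr_eq0.
Qed.

Lemma square_sum_first t : cong 4 (square_sum p (1 + p * t)%N%:R) (- block_value t).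
Proof.
elim: t => [|t IH]; last exact: square_sum_next.
rewrite muln0 addn0 square_sum1 /block_value.
apply: (@congI _ _ _ 2); first exact: rpred_nat.
by ring.
Qed.

(** At the last residue a = p - 1 the p^3 part from [square_sum_last] remains, and it
vanishes modulo p^4 only when p divides t; this occurs for p = 5 and x = -1/6. *)
Lemma square_sum_nat t a : (0 < a < p)%N -> (a != p.-1) || (p %| t)%N ->
  cong 4 (square_sum p (a + p * t)%N%:R) ((-1) ^+ a * block_value t).
Proof.
case/andP=> a_gt0 lt_ap /orP[ap|/dvdnP[k ->]].
  by apply: square_sum_block => //; [exact: square_sum_first|lia].
have [ap|ap] := eqVneq a p.-1; last first.
  by apply: square_sum_block => //; [exact: square_sum_first|lia].
rewrite ap signr_pred // mul1r.
apply: (cong_trans (square_sum_last (square_sum_first _))).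
apply: (@congI _ _ _ (P * (k%:R * P + 1) * k%:R ^+ 2)); first by in_subring.
by rewrite natrM; ring.
Qed.

(** The hypotheses say that d (a + p t) = p^4 - 1, so that a + p t represents -1/d
modulo p^4.  Since d t = -r modulo p^3, one has d^2 t (t+1) = - r (d - r), which
depends on d alone once r is 1 or d - 1. *)
Lemma square_sum_neg_inv (d r a t : nat) :
  (d * a + 1 = p * r)%N -> (d * t + r = p ^ 3)%N -> (r <= d)%N ->
  (r * (d - r) = d.-1)%N -> (0 < a < p)%N -> (a != p.-1) || (p %| t)%N ->
  cong 4 (square_sum p (- (1 / d%:R))) ((-1) ^+ a * (1 - (d%:R - 1) / d%:R ^+ 2) * P ^+ 2).
Proof.
move=> aE tE le_rd rE a_range ap.
have d_gt0 : (0 < d)%N.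
  rewrite lt0n; apply: contraTneq le_rd => d0; rewrite d0 leqn0.
  by apply: contra_eqN aE => /eqP ->; rewrite d0 muln0.
have pd : ~~ (p %| d)%N.
  apply/negP=> pd; have : (p %| d * a + 1)%N by rewrite aE dvdn_mulr.
  by rewrite dvdn_addr ?dvdn_mulr // dvdn1; lia.
have d0 : d%:R != 0 :> rat by rewrite pnatr_eq0 -lt0n.
have dZ : d%:R^-1 \in Zp by apply: plocal_inv_nat.
have aR : d%:R * a%:R = P * r%:R - 1 by rewrite -!natrM -aE natrD addrK.
have tR : d%:R * t%:R = P ^+ 3 - r%:R by rewrite -natrX -tE natrD natrM addrK.
have rR : r%:R * (d%:R - r%:R) = d%:R - 1 :> rat.
  by rewrite -natrB // -natrM rE -subn1 natrB.
apply: (@cong_trans 4 (square_sum p (a + p * t)%N%:R)).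
  apply: cong_square_sum; first exact: rpred_nat.
  apply: (@congI _ _ _ (- d%:R^-1)); first by rewrite rpredN.
  apply: (mulfI d0); rewrite natrD natrM.
  transitivity (-1 - (d%:R * a%:R + P * (d%:R * t%:R))); first by field.
  by rewrite aR tR; field.
apply: (cong_trans (square_sum_nat a_range ap)).
rewrite -mulrA; apply: congMl.
  by rewrite -signr_odd; case: (odd a); rewrite ?rpredN1 ?rpred1.
apply: (@congI _ _ _ (P * (P ^+ 3 + d%:R - 2 * r%:R) * d%:R^-1 ^+ 2)).
  by in_subring.
rewrite /block_value; have -> : t%:R = (P ^+ 3 - r%:R) / d%:R by rewrite -tR mulrC mulKf.
by rewrite -rR; field.
Qed.

(** * Legendre symbols of -1, -2 and -3 *)

Local Notation h := (p.-1./2).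

Lemma Fp_int_eq0 (c : int) : ((c%:~R : 'F_p) == 0) = (p %| c)%Z.
Proof. by rewrite -(dvdz_pcharf (pchar_Fp p_prime)). Qed.

Lemma Fp_fermat (x : 'F_p) : x != 0 -> x ^+ p.-1 = 1.
Proof.
move=> x0; apply: (mulfI x0); rewrite -exprS prednK ?prime_gt0 // mulr1.
by have := expf_card x; rewrite card_Fp.
Qed.

Lemma Fp_prim_root : exists z : 'F_p, p.-1.-primitive_root z.
Proof.
have p1 : (0 < p.-1)%N by have := prime_gt1 p_prime; lia.
have /hasP[z _ zP] : has p.-1.-primitive_root (enum (predC1 (0 : 'F_p))).
  apply: has_prim_root => //; last by rewrite -cardE cardC1 card_Fp.
    apply/allP=> x; rewrite mem_enum => x0; apply/unity_rootP; exact: Fp_fermat.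
  exact: enum_uniq.
by exists z.
Qed.

Lemma legendreP (c : int) : ~~ (p %| c)%Z ->
  legendre c p = if [exists y : 'F_p, y ^+ 2 == c%:~R] then 1 else -1.
Proof.
move=> pc; rewrite /legendre (negbTE pc).
have -> // : [exists x : 'I_p, ((x : nat)%:Z ^+ 2 == c %[mod p])%Z] =
  [exists y : 'F_p, y ^+ 2 == c%:~R].
have E (n : int) : (n ^+ 2 == c %[mod p])%Z = ((n%:~R : 'F_p) ^+ 2 == c%:~R).
  by rewrite eqz_mod_dvd -Fp_int_eq0 intrB rmorphXn subr_eq0.
apply/existsP/existsP=> [[x]|[y yc]].
  by rewrite E => xc; exists (x : nat)%:R.
have lt_yp : ((y : nat) < p)%N by rewrite -[X in (_ < X)%N](Fp_cast p_prime) ltn_ord.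
by exists (Ordinal lt_yp); rewrite E /= -pmulrn natr_Zp.
Qed.

Lemma Fp_two_neq0 : (2 : 'F_p) != 0.
Proof. by rewrite (Fp_int_eq0 2) dvdzE /= gtnNdvd //; lia. Qed.

(** In terms of a primitive root z, the power z^i has z^(i h) = 1 exactly when i is
even. *)
Lemma legendre_euler (c : int) (e : nat) :
  (c%:~R : 'F_p) ^+ h = (-1) ^+ e -> legendre c p = (-1) ^+ e.
Proof.
move=> ce; have c0 : (c%:~R : 'F_p) != 0.
  have h0 : h != 0%N by have := pred_half; lia.
  by apply: contra_eqN ce => /eqP ->; rewrite expr0n (negbTE h0) eq_sym signr_eq0.
rewrite legendreP -?Fp_int_eq0 //.
rewrite -signr_odd in ce; rewrite -signr_odd; case: (odd e) ce => /= ce; last first.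
  suff -> : [exists y : 'F_p, y ^+ 2 == c%:~R] by [].
  have [z zP] := Fp_prim_root.
  have [i ci] := prim_rootP zP (Fp_fermat c0).
  have : (p.-1 %| i * h)%N by rewrite (prim_order_dvd zP) exprM -ci ce.
  rewrite {1}pred_half dvdn_pmul2r; last by lia.
  move=> /dvdnP[j ij]; apply/existsP; exists (z ^+ j).
  by rewrite ci ij exprM.
case: existsP => // -[y /eqP yc]; exfalso.
have y0 : y != 0 by apply: contra_neq c0 => y0; rewrite -yc y0 expr0n.
move/eqP: ce; rewrite -yc -exprM -pred_half Fp_fermat // -addr_eq0.
by apply/negP; exact: Fp_two_neq0.
Qed.

Lemma legendreN1 : legendre (-1) p = (-1) ^+ h.
Proof. by apply: legendre_euler; rewrite intrN. Qed.

(** Gauss's argument: 2^h h! is the product of the even numbers up to 2 h = p - 1.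
Those above h are, modulo p, the opposites of the odd numbers up to h, and there
are [uphalf h] of them. *)
Lemma Fp_two_pow : (2 : 'F_p) ^+ h = (-1) ^+ uphalf h.
Proof.
have p0 : (p%:R : 'F_p) = 0 by apply: pchar_Fp_0.
have hf0 : (h`!%:R : 'F_p) != 0.
  by rewrite (Fp_int_eq0 h`!) dvdzE /= prime_ndvd_fact //; have := pred_half; lia.
apply: (mulIf hf0).
transitivity (\prod_(0 <= i < h) (2 * i.+1)%N%:R : 'F_p).
  rewrite fact_prod natr_prod big_add1 /= -[h in 2 ^+ h]subn0 -prodr_const_nat -big_split /=.
  by apply: eq_bigr => i _; rewrite natrM.
rewrite -fact_half_split natrM !natr_prod.
rewrite (big_cat_nat (n := h./2)) //=; last by lia.
rewrite mulrCA; congr (_ * _).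
have -> : uphalf h = (h - h./2)%N by rewrite uphalf_half; have := odd_double_half h; lia.
rewrite big_nat_rev -{1}[h./2]add0n big_addn.
rewrite -[in X in _ = X * _](subn0 (h - h./2)%N) -prodr_const_nat -big_split /=.
rewrite [LHS]big_nat [RHS]big_nat; apply: eq_bigr => i /andP[_ lt_ih].
rewrite mulN1r; apply/eqP; rewrite -addr_eq0 -natrD.
have -> : (2 * (h./2 + h - (i + h./2).+1).+1 + (2 * i).+1)%N = p by have := pred_half; lia.
by rewrite p0.
Qed.

Lemma legendreN2 : legendre (-2) p = (-1) ^+ (h + uphalf h).
Proof.
apply: legendre_euler; rewrite intrN [LHS]exprNn exprD; congr (_ * _).
exact: Fp_two_pow.
Qed.

(** If w is a primitive cube root of unity then (2 w + 1)^2 = -3; conversely a square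
root y of -3 yields the primitive cube root (y - 1) / 2.  Such roots exist exactly
when 3 divides p - 1. *)
Lemma legendreN3 : legendre (-3) p = if (p %% 3 == 1)%N then 1 else -1.
Proof.
have n3 : (3 : 'F_p) != 0 by rewrite (Fp_int_eq0 3) dvdzE /= gtnNdvd //; lia.
rewrite legendreP; last by rewrite -Fp_int_eq0 intrN oppr_eq0.
have [z zP] := Fp_prim_root.
have E3 : (p %% 3 == 1)%N = (3 %| p.-1)%N by have := prime_gt1 p_prime; lia.
rewrite E3; case: ifP => [/existsP[y /eqP yE]|/negbT/existsPn ny].
  suff -> : (3 %| p.-1)%N by [].
  have n2 := Fp_two_neq0.
  pose w := (y - 1) / 2.
  have w3 : w ^+ 3 = 1.
    apply/eqP; rewrite -subr_eq0.
    have -> : w ^+ 3 - 1 = (w - 1) * ((y ^+ 2 + 3) * 2^-1 ^+ 2) by rewrite /w; field; exact: n2.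
    by rewrite yE intrN addNr mul0r mulr0.
  have w1 : w != 1.
    apply: contra_neq n3 => w1.
    have yw : y = 3 by rewrite -[y](subrK 1) -[y - 1](divfK n2) -/w w1; ring.
    move: yE; rewrite yw => /eqP; rewrite -subr_eq0 intrN opprK.
    have -> : (3 : 'F_p) ^+ 2 + 3%:~R = 2 * 2 * 3 by ring.
    by rewrite !mulf_eq0 (negbTE n2) /= => /eqP.
  have wp : w ^+ p.-1 = 1.
    by apply: Fp_fermat; apply: contraTneq isT => w0; move: w3;
      rewrite w0 expr0n => /eqP; rewrite eq_sym oner_eq0.
  have [i wi] := prim_rootP zP wp.
  apply: contraR w1 => n3p; rewrite wi -(prim_order_dvd zP).
  have : (p.-1 %| i * 3)%N by rewrite (prim_order_dvd zP) exprM -wi w3.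
  by rewrite Gauss_dvdl // coprime_sym prime_coprime.
case: ifP => // d3; have wP := dvdn_prim_root zP d3.
set w := z ^+ _ in wP; have w3 := prim_expr_order wP.
have w1 : w != 1 by rewrite -[w]expr1 -(prim_order_dvd wP).
have wE : w ^+ 2 + w + 1 = 0.
  apply: (mulfI (_ : w - 1 != 0)); first by rewrite subr_eq0.
  by rewrite mulr0; transitivity (w ^+ 3 - 1); [ring | rewrite w3 subrr].
have /negP[] := ny (2 * w + 1); apply/eqP.
rewrite intrN; transitivity (4 * (w ^+ 2 + w + 1) - 3); first by ring.
by rewrite wE mulr0 add0r.
Qed.

End Prime.

(** * Conclusion *)

Lemma expn3_divn_eq (p d : nat) (r := (p %% d)%N) : (1 < d)%N -> (r ^ 3 %% d = r)%N ->
   (d * (p ^ 3 %/ d) + r = p ^ 3)%N.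
Proof.
by move=> d_gt1 r3; rewrite [RHS](divn_eq (p ^ 3) d) mulnC -modnXm -/r r3.
Qed.

Theorem theorem1p2 (p : nat) (p_prime : prime p) (p_ge5 : (5 <= p)%N) :
  [/\ cong_ppow p 4
        (\sum_(0 <= k < p) (2 * k + 1)%N%:R * s k (- (1 / 2)) ^+ 2)
        (3 / 4 * (legendre (-1) p)%:~R * p%:R ^+ 2),
      cong_ppow p 4
        (\sum_(0 <= k < p) (2 * k + 1)%N%:R * s k (- (1 / 3)) ^+ 2)
        (7 / 9 * (legendre (-3) p)%:~R * p%:R ^+ 2),
      cong_ppow p 4
        (\sum_(0 <= k < p) (2 * k + 1)%N%:R * s k (- (1 / 4)) ^+ 2)
        (13 / 16 * (legendre (-2) p)%:~R * p%:R ^+ 2)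
    & cong_ppow p 4
        (\sum_(0 <= k < p) (2 * k + 1)%N%:R * s k (- (1 / 6)) ^+ 2)
        (31 / 36 * (legendre (-1) p)%:~R * p%:R ^+ 2)].
Proof.
have pred2 := pred_half p_prime p_ge5.
have key (d r a : nat) (c : rat) (e : int) : (1 < d)%N -> (p %% d = r)%N -> (r ^ 3 %% d = r)%N ->
   (d * a + 1 = p * r)%N -> (r * (d - r) = d.-1)%N -> (0 < a < p)%N ->
   (a != p.-1) || (p %| p ^ 3 %/ d)%N -> e = (-1) ^+ a -> 1 - (d%:R - 1) / d%:R ^+ 2 = c ->
   cong_ppow p 4 (square_sum p (- (1 / d%:R))) (c * e%:~R * p%:R ^+ 2).
  move=> d_gt1 pr r3 aE rE a_range ap -> <-; rewrite rmorphXn rmorphN1 [_ * (-1) ^+ a]mulrC.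
  apply: (@square_sum_neg_inv p p_prime p_ge5 d r a (p ^ 3 %/ d)) => //.
    by rewrite -[in LHS]pr expn3_divn_eq // pr.
  by rewrite -pr ltnW // ltn_pmod // ltnW.
have p2 : (p %% 2 = 1)%N by lia.
have p3 : ~~ (3 %| p)%N by rewrite dvdn_prime2 //; lia.
split.
- apply: (@key 2 1 (p.-1./2)%N) => //; try lia; try field.
  exact: legendreN1.
- have [p1|p1] : (p %% 3 = 1)%N \/ (p %% 3 = 2)%N by lia.
    apply: (@key 3 1 (p.-1 %/ 3)%N) => //; try lia; try field.
    by rewrite legendreN3 // p1 -signr_odd (_ : odd _ = false) //; lia.
  apply: (@key 3 2 ((2 * p).-1 %/ 3)%N) => //; try lia; try field.
  by rewrite legendreN3 // p1 -signr_odd (_ : odd _ = true) //; lia.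
- have [p1|p1] : (p %% 4 = 1)%N \/ (p %% 4 = 3)%N by lia.
    apply: (@key 4 1 (p.-1 %/ 4)%N) => //; try lia; try field.
    by rewrite legendreN2 // -signr_odd -[RHS]signr_odd; congr (_ ^+ _); lia.
  apply: (@key 4 3 ((3 * p).-1 %/ 4)%N) => //; try lia; try field.
  by rewrite legendreN2 // -signr_odd -[RHS]signr_odd; congr (_ ^+ _); lia.
have [p1|p1] : (p %% 6 = 1)%N \/ (p %% 6 = 5)%N by lia.
  apply: (@key 6 1 (p.-1 %/ 6)%N) => //; try lia; try field.
  by rewrite legendreN1 // -signr_odd -[RHS]signr_odd; congr (_ ^+ _); lia.
apply: (@key 6 5 ((5 * p).-1 %/ 6)%N) => //; try lia; try field.
  (* For p = 5 the residue a is p - 1 = 4 and t = 20. *)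
  have [->|p5] := eqVneq p 5; first by [].
  by apply/orP; left; lia.
by rewrite legendreN1 // -signr_odd -[RHS]signr_odd; congr (_ ^+ _); lia.
Qed.
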